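(* Let $\mathfrak{g}$ be a Leibniz subalgebra of the Leibniz algebra $\Xi$, $\mathfrak{h}$ a given $\mathfrak{g}$-complement of $\Xi$ and $r:\mathfrak{h}\to\mathfrak{g}$ a deformation map of the associated canonical matched pair $(\mathfrak{g},\mathfrak{h},\triangleright,\triangleleft,\leftharpoonup,\rightharpoonup)$. (1) Let $f_r:\mathfrak{h}\to\Xi=\mathfrak{g}\bowtie\mathfrak{h}$ be the $k$-linear map $f_r(x)=(r(x),x)$ for $x\in\mathfrak{h}$. Then $\widetilde{\mathfrak{h}}:=\mathrm{Im}(f_r)$ is a $\mathfrak{g}$-complement of $\Xi$. (2) $\mathfrak{h}_r:=\mathfrak{h}$ as a vector space, with the new bracket defined for all $x,y\in\mathfrak{h}$ by $$[x,y]_r:=[x,y]+x\triangleleft r(y)+r(x)\rightharpoonup y,$$ is a Leibniz algebra (called the $r$-deformation of $\mathfrak{h}$). Furthermore, $\mathfrak{h}_r\cong\widetilde{\mathfrak{h}}$ as Leibniz algebras.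
   Context: All vector spaces and linear maps are over an arbitrary field $k$. A Leibniz algebra is a vector space with a bilinear bracket satisfying $[g,[h,l]]=[[g,h],l]-[[g,l],h]$. A $\mathfrak{g}$-complement of $\Xi$ is a Leibniz subalgebra $\mathfrak{h}$ of $\Xi$ with $\Xi=\mathfrak{g}+\mathfrak{h}$ and $\mathfrak{g}\cap\mathfrak{h}=\{0\}$. Given a $\mathfrak{g}$-complement $\mathfrak{h}$, let $p:\Xi\to\mathfrak{g}$, $p(g+x)=g$ for $g\in\mathfrak{g}$, $x\in\mathfrak{h}$. The canonical matched pair associated to $\Xi=\mathfrak{g}+\mathfrak{h}$ consists of the bilinear maps $\triangleright:\mathfrak{h}\times\mathfrak{g}\to\mathfrak{g}$, $\triangleleft:\mathfrak{h}\times\mathfrak{g}\to\mathfrak{h}$, $\leftharpoonup:\mathfrak{g}\times\mathfrak{h}\to\mathfrak{g}$, $\rightharpoonup:\mathfrak{g}\times\mathfrak{h}\to\mathfrak{h}$ given by $x\triangleright g=p([x,g])$, $x\triangleleft g=[x,g]-p([x,g])$, $g\leftharpoonup x=p([g,x])$, $g\rightharpoonup x=[g,x]-p([g,x])$. $\mathfrak{g}\bowtie\mathfrak{h}$ denotes $\mathfrak{g}\times\mathfrak{h}$ with bracket $[(g,x),(h,y)]=([g,h]+x\triangleright h+g\leftharpoonup y,\ [x,y]+x\triangleleft h+g\rightharpoonup y)$; it is identified with $\Xi$ via the Leibniz algebra isomorphism $(g,x)\mapsto g+x$, under which $\mathfrak{g}=\mathfrak{g}\times\{0\}$. A linear map $r:\mathfrak{h}\to\mathfrak{g}$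 is a deformation map of the matched pair if for all $x,y\in\mathfrak{h}$: $$r([x,y])-[r(x),r(y)]=x\triangleright r(y)+r(x)\leftharpoonup y-r\bigl(x\triangleleft r(y)+r(x)\rightharpoonup y\bigr).$$ *)

(* Defs.v *)
From HB Require Import structures.
From mathcomp Require Import all_boot all_order all_algebra.
From mathcomp Require Import ssrAC boolp classical_sets.

Set Implicit Arguments.
Unset Strict Implicit.
Unset Printing Implicit Defensive.

Import GRing.Theory.
Local Open Scope ring_scope.

(* Vector spaces are arbitrary [lmodType]s over a field, with no finiteness
   assumption.  Subspaces are boolean predicates; the classical axioms of
   [boolp] make every Prop-valued linear subspace representable this way.    *)
Record subspace (k : fieldType) (V : lmodType k) := Subspace {
  subspace_mem :> {pred V};
  subspace_closed : submod_closed subspace_mem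
}.

HB.instance Definition _ (k : fieldType) (V : lmodType k) (S : subspace V) :=
  GRing.isSubmodClosed.Build k V (subspace_mem S)
    (GRing.submod_closed_semi (subspace_closed S)).

Record subsp (k : fieldType) (V : lmodType k) (S : subspace V) : Type :=
  Subsp { subsp_val : V; subsp_valP : subsp_val \in subspace_mem S }.

HB.instance Definition _ (k : fieldType) (V : lmodType k)
  (S : subspace V) := [isSub for @subsp_val k V S].
HB.instance Definition _ (k : fieldType) (V : lmodType k)
  (S : subspace V) := [Choice of subsp S by <:].
HB.instance Definition _ (k : fieldType) (V : lmodType k)
  (S : subspace V) := [SubChoice_isSubZmodule of subsp S by <:].
HB.instance Definition _ (k : fieldType) (V : lmodType k)
  (S : subspace V) := [SubZmodule_isSubLmodule of subsp S by <:].

(* Corestriction to a subspace: v itself when v \in S, and 0 otherwise.  It is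
   only meant to be applied to vectors that do lie in S.                     *)
Definition cores (k : fieldType) (V : lmodType k) (S : subspace V) (v : V) :
  subsp S := insubd (0 : subsp S) v.

Lemma val_cores (k : fieldType) (V : lmodType k) (S : subspace V) (v : V) :
  v \in S -> val (cores S v) = v.
Proof. by move=> vS; rewrite insubdK. Qed.

Definition limage_pred (k : fieldType) (U V : lmodType k)
  (f : {linear U -> V}) : {pred V} := fun v => `[< exists u : U, v = f u >].

Lemma limage_closed (k : fieldType) (U V : lmodType k) (f : {linear U -> V}) :
  submod_closed (limage_pred f).
Proof.
split=> [|a _ _ /asboolP[x ->] /asboolP[y ->]]; apply/asboolP.
  by exists 0; rewrite linear0.
by exists (a *: x + y); rewrite linearP.
Qed.

Definition limage (k : fieldType) (U V : lmodType k) (f : {linear U -> V}) :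
  subspace V := Subspace (limage_closed f).

(* Right Leibniz convention. *)
Definition is_leibniz (k : fieldType) (L : lmodType k) (b : L -> L -> L) : Prop :=
  bilinear_for *:%R *:%R b /\
  forall x y z : L, b x (b y z) = b (b x y) z - b (b x z) y.

Definition leibniz_isomorphic (k : fieldType) (L M : lmodType k)
  (bL : L -> L -> L) (bM : M -> M -> M) : Prop :=
  exists phi : {linear L -> M},
    bijective phi /\ forall x y : L, phi (bL x y) = bM (phi x) (phi y).

Section Ambient.

Variables (k : fieldType) (Xi : lmodType k) (br : Xi -> Xi -> Xi).

Definition is_subalgebra (S : subspace Xi) : Prop :=
  forall u v : Xi, u \in S -> v \in S -> br u v \in S.

Definition sub_br (S : subspace Xi) (u v : subsp S) : subsp S :=
  cores S (br (val u) (val v)).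

Lemma val_sub_br (S : subspace Xi) (u v : subsp S) :
  is_subalgebra S -> val (sub_br u v) = br (val u) (val v).
Proof. by move=> clS; apply/val_cores/clS; apply: valP. Qed.

Definition is_complement (g h : subspace Xi) : Prop :=
  [/\ is_subalgebra h,
      forall v : Xi, exists a : subsp g, exists x : subsp h, v = val a + val x
    & forall v : Xi, v \in g -> v \in h -> v = 0].

Variables (g h : subspace Xi).

(* p : Xi -> g, p (a + x) = a; see [projE].  Junk value 0 when v is not in
   g + h. *)
Definition proj (v : Xi) : subsp g :=
  xget 0 [set a : subsp g | exists x : subsp h, v = val a + val x]%classic.

(* In this order: x |> a, x <| a, a leftharpoonup x, a rightharpoonup x.  By
   [proj_sub_in] the two corestrictions are to vectors that do lie in h when h
   is a g-complement. *)
Definition lact (x : subsp h) (a : subsp g) : subsp g :=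
  proj (br (val x) (val a)).
Definition ract (x : subsp h) (a : subsp g) : subsp h :=
  cores h (br (val x) (val a) - val (proj (br (val x) (val a)))).
Definition lharp (a : subsp g) (x : subsp h) : subsp g :=
  proj (br (val a) (val x)).
Definition rharp (a : subsp g) (x : subsp h) : subsp h :=
  cores h (br (val a) (val x) - val (proj (br (val a) (val x)))).

Definition bowtie_br (u v : subsp g * subsp h) : subsp g * subsp h :=
  (sub_br u.1 v.1 + lact u.2 v.1 + lharp u.1 v.2,
   sub_br u.2 v.2 + ract u.2 v.1 + rharp u.1 v.2).

(* The identification of the bicrossed product with Xi; it is a Leibniz algebra
   isomorphism by [bowtie_to_bij] and [bowtie_to_morph]. *)
Definition bowtie_to (u : subsp g * subsp h) : Xi := val u.1 + val u.2.

Lemma bowtie_to_is_linear : linear bowtie_to.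
Proof.
by move=> a u v; rewrite /bowtie_to !linearP scalerDr addrACA.
Qed.
HB.instance Definition _ := GRing.isLinear.Build k (subsp g * subsp h)%type Xi
  *:%R bowtie_to bowtie_to_is_linear.

Definition is_deformation_map (r : subsp h -> subsp g) : Prop :=
  forall x y : subsp h,
    r (sub_br x y) - sub_br (r x) (r y) =
    lact x (r y) + lharp (r x) y - r (ract x (r y) + rharp (r x) y).

Definition deformed_br (r : subsp h -> subsp g) (x y : subsp h) : subsp h :=
  sub_br x y + ract x (r y) + rharp (r x) y.

Definition graph_map (r : subsp h -> subsp g) (x : subsp h) :
  subsp g * subsp h := (r x, x).

Lemma graph_map_is_linear (r : {linear subsp h -> subsp g}) :
  linear (graph_map r).
Proof. by move=> a x y; rewrite /graph_map linearP. Qed.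
HB.instance Definition _ (r : {linear subsp h -> subsp g}) :=
  GRing.isLinear.Build k (subsp h) (subsp g * subsp h)%type
  *:%R (graph_map r) ((graph_map_is_linear r)).

Hypotheses (hbr : is_leibniz br) (hg : is_subalgebra g).
Hypothesis (hgh : is_complement g h).

Lemma decomp_uniq (a b : subsp g) (x y : subsp h) :
  val a + val x = val b + val y -> a = b /\ x = y.
Proof.
move=> e; case: hgh => _ _ cap.
have e' : val (a - b) = val (y - x).
  by apply/eqP; rewrite !raddfB subr_eq addrAC eq_sym subr_eq addrC -e addrC.
have z : val (a - b) = 0 by apply: cap; [exact: valP|rewrite e'; exact: valP].
have z' := esym (etrans (esym z) e').
by split; [|symmetry]; apply/eqP; rewrite -subr_eq0; apply/eqP/val_inj;
   rewrite raddf0.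
Qed.

Lemma projE (a : subsp g) (x : subsp h) : proj (val a + val x) = a.
Proof.
rewrite /proj; apply: xget_unique; first by exists x.
by move=> b [y /decomp_uniq[]].
Qed.

Lemma proj_sub_in (v : Xi) : v - val (proj v) \in h.
Proof.
case: hgh => _ /(_ v)[a [x ->]] _.
by rewrite projE addrAC subrr add0r; apply: valP.
Qed.

Lemma proj_add_cores (v : Xi) : val (proj v) + val (cores h (v - val (proj v))) = v.
Proof. by rewrite val_cores ?proj_sub_in// addrC subrK. Qed.

Lemma bowtie_to_bij : bijective bowtie_to.
Proof.
exists (fun v => (proj v, cores h (v - val (proj v)))) => [[a x]|v].
  rewrite /bowtie_to /= projE; congr pair; apply: val_inj.
  have e : val a + val x - val a = val x by rewrite addrAC subrr add0r.
  by rewrite val_cores e //; exact: valP.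
exact: proj_add_cores.
Qed.

Lemma bowtie_to_morph (u v : subsp g * subsp h) :
  bowtie_to (bowtie_br u v) = br (bowtie_to u) (bowtie_to v).
Proof.
case: u v => [a x] [b y]; case: hbr => -[bl bR] _; case: hgh => sh _ _.
have brDl w w' z : br (w + w') z = br w z + br w' z.
  have := bl z 1 w w'; rewrite /= !scale1r; apply.
have brDr z w w' : br z (w + w') = br z w + br z w'.
  have := bR z 1 w w'; rewrite /= !scale1r; apply.
rewrite /bowtie_to /= brDl !brDr.
have -> : br (val x) (val b) = val (lact x b) + val (ract x b).
  by rewrite proj_add_cores.
have -> : br (val a) (val y) = val (lharp a y) + val (rharp a y).
  by rewrite proj_add_cores.
rewrite -(val_sub_br a b hg) -(val_sub_br x y sh) /=.
by rewrite [RHS](AC ((1*2)*(2*1)) ((1*4*2)*(6*5*3))).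
Qed.

(* Im(f_r), moved from the bicrossed product to Xi by [bowtie_to]. *)
Definition graph_sub (r : {linear subsp h -> subsp g}) : subspace Xi :=
  limage (bowtie_to \o graph_map r).

End Ambient.

(* Main.v *)
Require Import Defs.
From mathcomp Require Import all_boot all_order all_algebra.
From HB Require Import structures.
From mathcomp Require Import boolp.

(** Under the isomorphism [(a, x) |-> a + x] from the bicrossed product to [Xi],
    the deformation equation says exactly that [F x = r x + x] satisfies
    [[F x, F y] = F [x, y]_r].  Hence the image of [F] is a subalgebra, and since
    [F] is injective the Leibniz identity pulls back to [[-, -]_r] and [F] becomes
    an isomorphism onto its image. *)

Set Implicit Arguments.
Unset Strict Implicit.
Unset Printing Implicit Defensive.

Import GRing.Theory.
Local Open Scope ring_scope.

Section InjectiveMorphism.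

Variables (k : fieldType) (L M : lmodType k) (f : {linear L -> M}).

Lemma mem_limage (x : L) : f x \in limage f.
Proof. by apply/asboolP; exists x. Qed.

Definition limage_corestr (x : L) : subsp (limage f) := cores (limage f) (f x).

Lemma val_limage_corestr (x : L) : val (limage_corestr x) = f x.
Proof. exact/val_cores/mem_limage. Qed.

Lemma limage_corestr_is_linear : linear limage_corestr.
Proof.
move=> a x y; apply: val_inj; rewrite val_limage_corestr !linearP /=.
by rewrite !val_limage_corestr.
Qed.
HB.instance Definition _ := GRing.isLinear.Build k L (subsp (limage f))
  *:%R limage_corestr limage_corestr_is_linear.

Lemma limage_corestr_bij : injective f -> bijective limage_corestr.
Proof.
move=> f_inj.
(* Membership in the image only asserts that a preimage exists; [cid] chooses one, so that the
   inverse becomes a function. *)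
have pre (w : subsp (limage f)) : {x | val w = f x}.
  by apply: cid; apply/asboolP; exact: (valP w).
exists (fun w => sval (pre w)) => [x|w].
  by apply: f_inj; rewrite -(svalP (pre _)) val_limage_corestr.
by apply: val_inj; rewrite val_limage_corestr -(svalP (pre _)).
Qed.

Variables (bL : L -> L -> L) (bM : M -> M -> M).
Hypothesis fM : forall x y, f (bL x y) = bM (f x) (f y).

Lemma limage_subalgebra : is_subalgebra bM (limage f).
Proof.
by move=> _ _ /asboolP[x ->] /asboolP[y ->]; rewrite -fM mem_limage.
Qed.

Hypothesis f_inj : injective f.

(** Each axiom is an equation in [L], so injectivity lets it be tested after applying [f], where
    [fM] turns it into the same axiom for [bM]. *)
Lemma is_leibniz_inj : is_leibniz bM -> is_leibniz bL.
Proof.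
case=> -[bl br] lz; split=> [|x y z].
  split=> [z|z] a x y; apply: f_inj; rewrite /= linearP !fM linearP /=.
    exact: bl.
  exact: br.
by apply: f_inj; rewrite linearB !fM.
Qed.

Lemma limage_isomorphic : leibniz_isomorphic bL (@sub_br k M bM (limage f)).
Proof.
exists limage_corestr; split; first exact: limage_corestr_bij.
move=> x y; apply: val_inj; rewrite val_sub_br; last exact: limage_subalgebra.
by rewrite !val_limage_corestr.
Qed.

End InjectiveMorphism.

Section Graph.

Variables (k : fieldType) (Xi : lmodType k) (br : Xi -> Xi -> Xi).
Variables (g h : subspace Xi) (r : {linear subsp h -> subsp g}).
Hypothesis hgh : is_complement br g h.

(** The [h]-component of [r x + x] is [x], and decompositions along [g] and [h] are unique. *)
Lemma graph_inj : injective (@bowtie_to k Xi g h \o graph_map r).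
Proof. by move=> x y /(decomp_uniq hgh)[]. Qed.

Lemma graph_morph (hXi : is_leibniz br) (hg : is_subalgebra br g)
    (hr : is_deformation_map br r) (x y : subsp h) :
  bowtie_to (graph_map r (deformed_br br r x y)) =
  br (bowtie_to (graph_map r x)) (bowtie_to (graph_map r y)).
Proof.
rewrite -(bowtie_to_morph hXi hg hgh) /graph_map /bowtie_br /=.
(* The [h]-components agree by definition of [deformed_br]; the [g]-component remains, and [hr]
   settles it once [r] is distributed over the sum. *)
congr (bowtie_to (_, _)); rewrite /deformed_br -addrA linearD.
have /eqP := hr x y; rewrite subr_eq => /eqP ->.
by rewrite addrAC subrK addrC addrA.
Qed.

Lemma graph_complement :
  is_subalgebra br (graph_sub r) -> is_complement br g (graph_sub r).
Proof.
move=> sub; split=> // [v|v vg /asboolP[x]].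
  case: hgh => _ /(_ v)[a [x ->]] _.
  (* The witnesses come from [a + x = (a - r x) + (r x + x)]. *)
  pose w := limage_corestr (bowtie_to (h:=h) \o graph_map r) x.
  have ew : val w = val (r x) + val x := val_limage_corestr _ x.
  by exists (a - r x), w; rewrite ew raddfB addrA subrK.
(* Both [v + 0] and [r x + x] decompose the same vector along [g] and [h]; uniqueness forces
   [x = 0], hence [v = r 0 = 0]. *)
have ev : v = val (Subsp vg) + val (0 : subsp h) by rewrite raddf0 addr0.
rewrite ev => /(decomp_uniq hgh)[-> /= x0].
by rewrite -x0 linear0 addr0.
Qed.

End Graph.

Theorem theorem5p2 (k : fieldType) (Xi : lmodType k) (br : Xi -> Xi -> Xi)
  (hXi : is_leibniz br)
  (g : subspace Xi) (hg : is_subalgebra br g)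
  (h : subspace Xi) (hgh : is_complement br g h)
  (r : {linear subsp h -> subsp g}) (hr : is_deformation_map br r) :
  is_complement br g (graph_sub r)
  /\ (is_leibniz (deformed_br br r)
      /\ leibniz_isomorphic (deformed_br br r) (@sub_br k Xi br (graph_sub r))).
Proof.
(* With this [f], [graph_sub r] unfolds to [limage f], so the facts about injective
   bracket-preserving maps apply to it. *)
pose f : {linear subsp h -> Xi} := @bowtie_to k Xi g h \o graph_map r.
have f_morph (x y : subsp h) : f (deformed_br br r x y) = br (f x) (f y).
  exact: graph_morph.
have f_inj : injective f := graph_inj (r := r) hgh.
split; first exact/graph_complement/(limage_subalgebra f_morph).
split; first exact: is_leibniz_inj f_morph f_inj hXi.
exact: (limage_isomorphic f_morph f_inj).
Qed.
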